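(* Let $T$ be a fixed finite rooted tree with node set $V$, and let $\varkappa_k(I(T))$ be the $k$-th cumulant of $I(T)$. Then $$\mathbb E[I(T)]=\varkappa_1(I(T))=\tfrac12\Upsilon(T)=\tfrac12\bigl(\Upsilon_1(T)-|V|\bigr),$$ $$\mathrm{Var}(I(T))=\varkappa_2(I(T))=\tfrac1{12}\bigl(\Upsilon_2(T)-|V|\bigr),$$ and, more generally, for $k\ge1$, $$\varkappa_{2k+1}(I(T))=0,\qquad \varkappa_{2k}(I(T))=\frac{B_{2k}}{2k}\bigl(\Upsilon_{2k}(T)-|V|\bigr),$$ where $B_k$ is the $k$-th Bernoulli number. Moreover, $I(T)$ has the moment generating function $$\mathbb E\bigl[e^{tI(T)}\bigr]=\prod_{v\in V}\frac{e^{z_vt}-1}{z_v(e^t-1)}$$ (each factor being interpreted as $1$ at $t=0$), and for the centralized variable, for all $t\in\mathbb R$, $$\mathbb E\bigl[e^{t(I(T)-\mathbb E[I(T)])}\bigr]\le\exp\Bigl(\tfrac18t^2\sum_{v\in V}(z_v-1)^2\Bigr)\le\exp\Bigl(\tfrac18t^2\sum_{v\in V}z_v^2\Bigr)=\exp\Bigl(\tfrac18t^2\,\Upsilon_2(T)\Bigr).$$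
   Context: For nodes $u,v$ of a rooted tree, $u<v$ means that $u$ is a proper ancestor of $v$, and $u\le v$ means $u<v$ or $u=v$. For a bijection $\lambda:V\to\{1,\dots,|V|\}$ let $I(T,\lambda)=\sum_{u<v}\mathbf 1_{\lambda(u)>\lambda(v)}$; $I(T)$ is $I(T,\lambda)$ with $\lambda$ a uniformly random such bijection. $z_v$ is the number of nodes of the subtree rooted at $v$ (including $v$). $\Upsilon(T)=\sum_v h(v)$ is the total path length, where $h(v)$ is the depth of $v$ (number of edges from $v$ to the root). For not necessarily distinct nodes $v_1,\dots,v_k$, $c(v_1,\dots,v_k)=|\{u\in V:u\le v_1,\dots,u\le v_k\}|$ is the number of common ancestors, and $\Upsilon_k(T)=\sum_{v_1,\dots,v_k}c(v_1,\dots,v_k)$, summed over all ordered $k$-tuples of nodes of $T$. Bernoulli numbers are defined by $\sum_{k\ge0}B_kx^k/k!=x/(e^x-1)$. *)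

(* Defs.v *)
From mathcomp Require Import all_boot all_order all_algebra.
From mathcomp Require Import all_classical all_reals all_analysis.

Set Implicit Arguments.
Unset Strict Implicit.
Unset Printing Implicit Defensive.

Import Order.TTheory GRing.Theory Num.Theory.
Import numFieldNormedType.Exports.

Local Open Scope classical_set_scope.
Local Open Scope ring_scope.

(* A rooted tree on the node set V is encoded by its parent map, with a loop
   at the root; since every node reaches the root, this loop is the only
   cycle, and the edges of the tree are the pairs {v, parent v}, v != root. *)
Record rooted_tree (V : finType) := RootedTree {
  root : V;
  parent : V -> V;
  parent_root : parent root = root;
  root_reachable : forall v : V, fconnect parent v root
}.

(* The values {1, ..., |V|} are shifted to {0, ..., |V| - 1}; by equality of
   the cardinals, an injection V -> 'I_#|V| is a bijection. *)
Definition labeling (V : finType) : Type :=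
  {l : {ffun V -> 'I_#|V|} | injectiveb l}.

Section Trees.
Variables (V : finType) (T : rooted_tree V).

Definition anc_le (u v : V) : bool := fconnect (parent T) v u.

Definition anc_lt (u v : V) : bool := (u != v) && anc_le u v.

Definition subtree_size (v : V) : nat := #|[pred u | anc_le v u]|.

Definition depth (v : V) : nat := findex (parent T) v (root T).

Definition path_length : nat := (\sum_(v : V) depth v)%N.

Definition common_ancestors (s : seq V) : nat := #|[pred u | all (anc_le u) s]|.

Definition Upsilon (k : nat) : nat :=
  (\sum_(s : k.-tuple V) common_ancestors s)%N.

Definition inversions (l : labeling V) : nat :=
  (\sum_(u : V) \sum_(v : V | anc_lt u v) (val l v < val l u))%N.

End Trees.

Section Probability.
Local Open Scope ereal_scope.
Context d (Omega : measurableType d) (R : realType) (P : probability Omega R).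

Definition uniform_labeling (V : finType) (lam : Omega -> labeling V) : Prop :=
  forall l : labeling V,
    measurable (lam @^-1` [set l]) /\
    P (lam @^-1` [set l]) = ((#|{: labeling V}|%:R)^-1)%:E.

Definition inversion_number (V : finType) (T : rooted_tree V)
    (lam : Omega -> labeling V) (w : Omega) : R :=
  (inversions T (lam w))%:R.

(* The cumulant generating function t |-> ln E[e^(t X)] is differentiated k
   times at 0. *)
Definition cumulant (X : Omega -> R) (k : nat) : R :=
  ((fun t : R => ln (fine ('M_ P X t))) ^`(k))%classic 0%R.

End Probability.

Section Bernoulli.
Variable R : realType.

(* Convergence is only required for x near 0, x != 0; by uniqueness of power
   series coefficients this determines B. *)
Definition bernoulli_egf (B : nat -> R) : Prop :=
  \forall x \near (0 : R)^',
    pseries (fun k => B k / k`!%:R) x @ \oo --> x / (expR x - 1).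

(* The coefficients c k = B_k / k!, computed by the recursion
   \sum_(j <= n) c j / (n + 1 - j)! = [n = 0]. *)
Fixpoint bern_table (n : nat) : seq R :=
  if n is m.+1 then
    rcons (bern_table m)
      ((m == 0%N)%:R - \sum_(j < m) (bern_table m)`_j / (m.+1 - j)`!%:R)
  else [::].

Let c (n : nat) : R := (bern_table n.+1)`_n.

Lemma size_bern_table n : size (bern_table n) = n.
Proof. by elim: n => //= n IH; rewrite size_rcons IH. Qed.

Lemma nth_bern_table n j : (j < n)%N -> (bern_table n)`_j = c j.
Proof.
elim: n => // n IH; rewrite ltnS leq_eqVlt => /orP[/eqP-> //|jn].
by rewrite /= nth_rcons size_bern_table jn IH.
Qed.

Let c_rec n : \sum_(j < n.+1) c j / (n.+1 - j)`!%:R = (n == 0%N)%:R.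
Proof.
rewrite big_ord_recr /= subSn // subnn divr1 /c /= nth_rcons size_bern_table.
rewrite ltnn eqxx addrC -addrA (_ : - _ + _ = 0) ?addr0 //.
rewrite addrC -sumrB big1 // => j _.
by rewrite -[(rcons _ _)`_j]/(c j) nth_bern_table ?subrr.
Qed.

Let c_le n : `|c n| <= 2 ^+ n.
Proof.
elim/ltn_ind: n => n IH.
have := c_rec n; rewrite big_ord_recr /= subSn // subnn divr1.
move=> /(canRL (addKr _)) ->; rewrite [- _ + _]addrC.
case: n IH => [|n] IH; first by rewrite big_ord0 subr0 normr1.
rewrite /= sub0r normrN (le_trans (ler_norm_sum _ _ _)) //.
apply: (@le_trans _ _ (\sum_(j < n.+1) 2 ^+ j)).
  apply: ler_sum => j _; rewrite normrM (le_trans _ (IH j _)) //.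
  rewrite ler_piMr // normfV normr_nat invf_le1 ?ltr0n ?fact_gt0 //.
  by rewrite ler1n fact_gt0.
elim: {IH} n.+1 => [|m IHm]; first by rewrite big_ord0 expr0 ler01.
by rewrite big_ord_recr /= exprS mulr2n mulrDl mul1r lerD2r.
Qed.

Let e (i : nat) : R := (i.+1`!%:R)^-1.

Let tri_sum (x : R) N :
  \sum_(j < N.+1) \sum_(i < N.+1 - j) (c j * x ^+ j) * (e i * x ^+ i) = 1.
Proof.
elim: N => [|N IH].
  rewrite big_ord1 subn0 big_ord1 !expr0 !mulr1.
  by have := c_rec 0; rewrite big_ord1.
rewrite big_ord_recr /= subSn // subnn big_ord1.
under eq_bigr => j _.
  rewrite subSn; last exact: ltnW (ltn_ord j).
  rewrite big_ord_recr /=.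
over.
rewrite big_split /= IH -addrA.
suff -> : \sum_(j < N.+1) c j * x ^+ j * (e (N.+1 - j) * x ^+ (N.+1 - j)) +
    c N.+1 * x ^+ N.+1 * (e 0 * x ^+ 0) = 0 by rewrite addr0.
have := congr1 (fun y => x ^+ N.+1 * y) (c_rec N.+1).
rewrite mulr0 big_ord_recr /= subSn // subnn mulrDr mulr_sumr => R0.
rewrite -[RHS]R0.
congr (_ + _); last by rewrite expr0 mulr1 /e [LHS]mulrAC [LHS]mulrC.
apply: eq_bigr => j _.
have jN : (j <= N.+1)%N by rewrite ltnW.
rewrite (subSn jN); have -> : x ^+ N.+1 = x ^+ j * x ^+ (N.+1 - j).
  by rewrite -exprD subnKC.
by rewrite [LHS]mulrACA [LHS]mulrC.
Qed.

Let S (x : R) N := \sum_(j < N) c j * x ^+ j.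
Let E (x : R) N := \sum_(i < N) e i * x ^+ i.

Let SE_bound (x : R) N : `|x| <= 1 ->
  `|S x N.+1 * E x N.+1 - 1| <= (8 * `|x|) ^+ N.+1.
Proof.
move=> x1; rewrite -[X in _ - X](tri_sum x N) /S /E mulr_suml -sumrB.
rewrite (le_trans (ler_norm_sum _ _ _)) //.
have main (j : 'I_N.+1) :
  `|c j * x ^+ j * (\sum_(i < N.+1) e i * x ^+ i) -
    \sum_(i < N.+1 - j) c j * x ^+ j * (e i * x ^+ i)|
   <= N.+1%:R * (2 * `|x|) ^+ N.+1.
  rewrite mulr_sumr.
  rewrite -!(big_mkord xpredT (fun i => c j * x ^+ j * (e i * x ^+ i))).
  rewrite (@big_cat_nat _ _ _ (N.+1 - j)%N) ?leq_subr //= addrAC subrr add0r.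
  rewrite (le_trans (ler_norm_sum _ _ _)) //.
  apply: (@le_trans _ _ (\sum_(N.+1 - j <= i < N.+1) (2 * `|x|) ^+ N.+1)).
    rewrite big_nat_cond [leRHS]big_nat_cond; apply: ler_sum => i.
    rewrite andbT leq_subLR => /andP[Nji iN].
    rewrite mulrACA -exprD !normrM normrX exprMn.
    apply: ler_pM => //; last by apply: ler_wiXn2l.
    rewrite -[leRHS]mulr1; apply: ler_pM => //.
      rewrite (le_trans (c_le j)) // ler_weXn2l ?ler1n //.
      by rewrite ltnW.
    by rewrite /e normfV normr_nat invf_le1 ?ltr0n ?ler1n ?fact_gt0.
  rewrite sumr_const_nat -[leLHS]mulr_natl ler_wpM2r ?exprn_ge0 ?mulr_ge0 //.
  by rewrite ler_nat leq_subr.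
apply: (le_trans (ler_sum _ (fun j _ => main j))).
rewrite sumr_const card_ord -[leLHS]mulr_natl mulrA.
rewrite (_ : 8 * `|x| = (2 * 2) * (2 * `|x|)); last by rewrite !mulrA -!natrM.
rewrite [leRHS]exprMn.
rewrite ler_wpM2r ?exprn_ge0 ?mulr_ge0 // exprMn.
have N2 : N.+1%:R <= 2 ^+ N.+1 :> R by rewrite -natrX ler_nat ltnW // ltn_expl.
by apply: ler_pM.
Qed.

Lemma exists_bernoulli : exists B : nat -> R, bernoulli_egf B.
Proof.
exists (fun k => c k * k`!%:R); rewrite /bernoulli_egf.
near=> x.
have x0 : x != 0 by near: x; exact: nbhs_dnbhs_neq.
have x16 : `|x| < 16^-1.
  near: x; apply: dnbhs0_lt; by rewrite invr_gt0.
have e0 : expR x - 1 != 0.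
  by rewrite subr_eq0 -expR0 (inj_eq (@expR_inj R)).
have -> : pseries (fun k => c k * k`!%:R / k`!%:R) x = S x.
  apply/funext => n; rewrite /pseries /series /= big_mkord.
  by apply: eq_bigr => i _; rewrite mulfK // pnatr_eq0 -lt0n fact_gt0.
have cE : E x @ \oo --> (expR x - 1) / x.
  have -> : E x = (fun n => (series (exp_coeff x) n.+1 - 1) / x).
    apply/funext => n; rewrite /series /= big_mkord big_ord_recl /=.
    rewrite /exp_coeff /= expr0 fact0 divr1 addrAC subrr add0r mulr_suml.
    apply: eq_bigr => i _; rewrite /bump /= add1n exprS /e.
    by rewrite mulrAC [x * _]mulrC mulfK // mulrC.
  apply: cvgMr_tmp; apply: cvgB; last exact: cvg_cst.
  rewrite (cvg_shiftS (series (exp_coeff x))) /=.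
  exact: is_cvg_series_exp_coeff.
have cSE : (fun n => S x n * E x n) @ \oo --> (1 : R).
  apply/subr_cvg0/norm_cvg0P.
  apply: (@squeeze_cvgr _ _ _ _ (cst 0) (fun n => (8 * `|x|) ^+ n)).
  - near=> n; rewrite normr_ge0 /=.
    have /prednK<- : (0 < n)%N by near: n; exact: nbhs_infty_gt.
    apply: SE_bound.
    by apply: ltW; apply: (lt_trans x16); rewrite invf_lt1 // ltr1n.
  - exact: cvg_cst.
  - apply: cvg_expr; rewrite ger0_norm ?mulr_ge0 //.
    rewrite mulrC -ltr_pdivlMr // (lt_le_trans x16) //.
    by rewrite div1r lef_pV2 ?posrE // ler_nat.
have lim0 : (expR x - 1) / x != 0 by rewrite mulf_neq0 // invr_eq0.
have -> : x / (expR x - 1) = 1 * ((expR x - 1) / x)^-1.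
  by rewrite mul1r invfM invrK mulrC.
have cV := cvgM cSE (cvgV lim0 cE).
suff H : \forall n \near \oo, S x n * E x n * (E x n)^-1 = S x n.
  exact: (cvg_trans (near_eq_cvg H) (cV _ _)).
near=> n; rewrite mulfK //.
by near: n; exact: cvgr_neq0 cE lim0.
Unshelve. all: by end_near. Qed.

Definition bernoulli : nat -> R := sval (cid exists_bernoulli).

Lemma bernoulliP : bernoulli_egf bernoulli.
Proof. exact: svalP. Qed.

End Bernoulli.

(* Main.v *)
Require Import Defs.
From mathcomp Require Import all_boot all_order all_algebra.
From mathcomp Require Import all_classical all_reals all_analysis.
From mathcomp Require Import fingroup perm zify ring lra.

Import Order.TTheory GRing.Theory Num.Theory.
Import numFieldNormedType.Exports.

Set Implicit Arguments.
Unset Strict Implicit.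
Unset Printing Implicit Defensive.

Local Open Scope classical_set_scope.
Local Open Scope ring_scope.

(** For a labeling l let R_v(l) be the number of nodes of the subtree at v whose
    label is smaller than that of v, so that the inversion number is the sum of
    the R_v.  The whole theorem rests on one fact: for a uniformly random
    labeling the R_v are independent and R_v is uniform on {0, ..., z_v - 1}
    (subtree_ranks_independent).  The reason is a family of involutions of the
    labelings: exchanging the labels that have the ranks j and j + 1 within the
    subtree at v moves R_v from j to j + 1 or back, and leaves every other R_w
    untouched, because no label of the subtree lies strictly between the two
    (exchangeK, subtree_rank_exchange_other).

    The moment generating function is therefore the product of those of the
    uniform laws, which are geometric sums, and with q(x) = (e^x - 1) / x the
    factor of v is q(z_v t) / q(t) (uniform_mgfE, avg_expR_inversions).

    Cumulants: the logarithm of the product is the sum over v of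
    ln q(z_v t) - ln q(t), so it suffices to expand ln q at 0.  Since
    x (ln q)'(x) = x / (e^x - 1) + x - 1, the coefficients are
    B_n / (n n!) for n > 1 and 1/2 for n = 1 (has_pseries_ln_exp_quotient), and
    summing z_v^n - 1 over v produces Upsilon_n - |V| (Upsilon_subtree).  The
    odd Bernoulli numbers vanish by the reflection x -> -x
    (bernoulli_odd).  That the first two cumulants are the mean and the variance
    is checked on an arbitrary finite average of exponentials
    (log_mgf_derive1, log_mgf_derive2); applied to a fair coin, the same formula
    gives B_2 = 1/6 (bernoulli2).

    Tail bound: the centred uniform law on z points is symmetric and lives in
    [-(z - 1)/2, (z - 1)/2], so its moment generating function is an average of
    values of cosh, each at most cosh (t (z - 1) / 2) <= exp (t^2 (z - 1)^2 / 8)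
    (uniform_mgf_le); the bounds multiply over v. *)

(** * Double counting *)

Lemma sum_card_exchange (I J : finType) (r : I -> pred J) :
  (\sum_(i : I) #|[pred j | r i j]| = \sum_(j : J) #|[pred i | r i j]|)%N.
Proof.
under eq_bigr do rewrite -sum1_card big_mkcond /=.
by rewrite exchange_big; apply: eq_bigr => j _; rewrite -sum1_card [RHS]big_mkcond.
Qed.

Lemma card_all_tuple (V : finType) (A : pred V) k :
  #|[pred s : k.-tuple V | all A s]| = (#|A| ^ k)%N.
Proof.
pose h (f : {ffun 'I_k -> V}) : k.-tuple V := [tuple f i | i < k].
have h_inj : injective h.
  by move=> f g fg; apply/ffunP => i; have := congr1 (fun s => tnth s i) fg; rewrite !tnth_mktuple.
rewrite -[in RHS](card_ord k) -card_ffun_on -(fintype.card_image h_inj).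
apply: eq_card => s; have -> : s = h [ffun i => tnth s i].
  by apply: eq_from_tnth => i; rewrite tnth_mktuple ffunE.
rewrite fintype.mem_image // inE; apply/all_tnthP/ffun_onP => sA i; have := sA i.
  by rewrite ffunE tnth_mktuple ffunE.
by rewrite ffunE tnth_mktuple ffunE.
Qed.

(** * The ancestor order *)

Section AncestorOrder.
Variables (V : finType) (T : rooted_tree V).

Lemma anc_leP u v : reflect (exists n, u = iter n (parent T) v) (anc_le T u v).
Proof.
apply: (iffP idP) => [uv|[n ->]]; last exact: fconnect_iter.
by exists (findex (parent T) v u); rewrite iter_findex.
Qed.

Lemma anc_le_refl u : anc_le T u u.
Proof. exact: connect0. Qed.

Lemma anc_le_trans v u w : anc_le T u v -> anc_le T v w -> anc_le T u w.
Proof. by move=> uv vw; exact: connect_trans vw uv. Qed.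

Lemma iter_parent_root n : iter n (parent T) (Defs.root T) = Defs.root T.
Proof. by elim: n => //= n ->; exact: parent_root. Qed.

Lemma iter_parent_ge v n : (depth T v <= n)%N -> iter n (parent T) v = Defs.root T.
Proof.
move=> /subnK <-; rewrite iterD iter_findex ?iter_parent_root //.
exact: root_reachable.
Qed.

(** If u and v were ancestors of each other, some power of the parent map would
    fix u; its iterates eventually sit at the root, so u is the root, which has
    no other ancestor. *)
Lemma anc_le_anti u v : anc_le T u v -> anc_le T v u -> u = v.
Proof.
move=> /anc_leP[n un] /anc_leP[m vm].
have uk k : u = iter (k * (n + m)) (parent T) u.
  elim: k => // k IH; rewrite mulSn iterD -IH iterD -vm.
  exact: un.
have [nm0|nm0] := posnP (n + m)%N.
  by move: nm0 un => /eqP; rewrite addn_eq0 => /andP[/eqP-> _].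
have ur : u = Defs.root T.
  by rewrite (uk (depth T u)) iter_parent_ge // leq_pmulr.
by rewrite vm ur iter_parent_root.
Qed.

Lemma anc_le_total u v w : anc_le T u w -> anc_le T v w ->
  anc_le T u v || anc_le T v u.
Proof.
move=> /anc_leP[n ->] /anc_leP[m ->].
have [nm|/ltnW mn] := leqP n m.
  by apply/orP; right; rewrite -(subnK nm) iterD; exact: fconnect_iter.
by apply/orP; left; rewrite -(subnK mn) iterD; exact: fconnect_iter.
Qed.

(** The iterates of the parent map at v are distinct up to the root and
    stationary from there on. *)
Lemma card_ancestors v : #|[pred u | anc_le T u v]| = (depth T v).+1.
Proof.
have -> : #|[pred u | anc_le T u v]| = fingraph.order (parent T) v by [].
apply/eqP; rewrite eqn_leq; apply/andP; split; last first.
  by apply: findex_max; exact: root_reachable.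
rewrite -(size_traject (parent T) v (depth T v).+1) -size_orbit.
apply: uniq_leq_size; first exact: orbit_uniq.
move=> u; rewrite -fconnect_orbit => /anc_leP[n ->].
apply/trajectP; have [nd|dn] := leqP n (depth T v); first by exists n.
by exists (depth T v); rewrite // !iter_parent_ge // ltnW.
Qed.

(** A node u is a common ancestor of exactly the k-tuples with all entries in
    its subtree. *)
Lemma Upsilon_subtree k : Upsilon T k = (\sum_v subtree_size T v ^ k)%N.
Proof.
rewrite /Upsilon /common_ancestors.
rewrite (@sum_card_exchange _ _ (fun (s : k.-tuple V) u => all (anc_le T u) s)).
by apply: eq_bigr => v _; rewrite card_all_tuple.
Qed.

Lemma path_lengthD : (path_length T + #|V| = Upsilon T 1)%N.
Proof.
rewrite Upsilon_subtree -sum1_card -big_split /=.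
under [RHS]eq_bigr do rewrite expn1.
rewrite /subtree_size (@sum_card_exchange _ _ (anc_le T)).
by apply: eq_bigr => v _; rewrite card_ancestors addn1.
Qed.

End AncestorOrder.

(** * Ranks of labels within subtrees *)

Section SubtreeRanks.
Variables (V : finType) (T : rooted_tree V).
Implicit Types (l : labeling V) (s : {perm V}) (A : pred V) (u v w : V).

Lemma labeling_inj l : injective (val l).
Proof. exact: (injectiveP _ (valP l)). Qed.

Definition rank A l v : nat := #|[pred u | (u \in A) && (val l u < val l v)%N]|.

Definition subtree v : pred V := [pred u | anc_le T v u].

Definition subtree_rank l v : nat := rank (subtree v) l v.

Lemma inversions_rank l : inversions T l = (\sum_v subtree_rank l v)%N.
Proof.
apply: eq_bigr => u _; rewrite /subtree_rank /rank -[RHS]sum1_card.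
rewrite [LHS]big_mkcond [RHS]big_mkcond; apply: eq_bigr => v _; rewrite !inE /anc_lt.
by case: eqVneq => [->|_] /=; rewrite ?ltnn ?andbF //; case: anc_le; case: ltnP.
Qed.

Lemma ltn_rank A l u v : u \in A -> v \in A ->
  (rank A l u < rank A l v)%N = (val l u < val l v)%N.
Proof.
move=> Au Av; have mono x y : (val l x <= val l y)%N -> (rank A l x <= rank A l y)%N.
  move=> xy; apply/subset_leq_card/fintype.subsetP => w; rewrite !inE.
  by move=> /andP[-> wx]; exact: leq_trans wx xy.
apply/idP/idP => [|uv]; first by apply: contraTT; rewrite -!leqNgt; exact: mono.
apply/proper_card/properP; split; last by exists u; rewrite !inE ?Au ?uv ?ltnn ?andbF.
apply/fintype.subsetP => w; rewrite !inE.
by move=> /andP[-> wx]; exact: ltn_trans wx uv.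
Qed.

Lemma rank_inj A l : {in A &, injective (rank A l)}.
Proof.
move=> u v Au Av uv; apply/(@labeling_inj l)/val_inj.
by case: (ltngtP (val l u) (val l v)) => //; rewrite -(@ltn_rank A) // uv ltnn.
Qed.

Lemma rank_lt A l v : v \in A -> (rank A l v < #|A|)%N.
Proof.
move=> Av; apply/proper_card/properP; split; last by exists v; rewrite // inE ltnn andbF.
by apply/fintype.subsetP => w; rewrite !inE => /andP[].
Qed.

Lemma rank_surj A l j : (j < #|A|)%N -> exists2 u, u \in A & rank A l u = j.
Proof.
move=> jA; pose r (x : {x | x \in A}) := Ordinal (@rank_lt A l (val x) (valP x)).
have r_inj : injective r by move=> x y [xy]; apply/val_inj/(rank_inj _ _ xy); exact: valP.
have /(_ (Ordinal jA)) : forall i, i \in codom r.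
  by apply: inj_card_onto => //; rewrite card_ord card_sig.
by case/codomP => x [jx]; exists (val x); [exact: valP | rewrite jx].
Qed.

Lemma relabel_subproof l s : injectiveb [ffun x => val l (s x)].
Proof.
by apply/injectiveP => x y; rewrite !ffunE => /labeling_inj/perm_inj.
Qed.

Definition relabel s l : labeling V :=
  exist (fun f : {ffun V -> 'I_#|V|} => injectiveb f) _ (relabel_subproof l s).

Lemma relabelE s l x : val (relabel s l) x = val l (s x).
Proof. by rewrite ffunE. Qed.

Lemma relabelK s : involutive s -> involutive (relabel s).
Proof.
move=> ss l; apply/val_inj/ffunP => x.
by rewrite !relabelE ss.
Qed.

Lemma rank_relabel A l s v : (forall x, (s x \in A) = (x \in A)) ->
  rank A (relabel s l) v = rank A l (s v).
Proof.
move=> sA; rewrite /rank -(fintype.card_image (@perm_inj _ s)); apply: eq_card => u.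
have [w ->] : exists w, u = s w by exists ((s^-1)%g u); rewrite permKV.
by rewrite fintype.mem_image; [rewrite !inE !relabelE sA | exact: perm_inj].
Qed.

(** Meaningful for j smaller than the subtree size; v is only a default. *)
Definition node_at v l j : V := odflt v [pick u in subtree v | rank (subtree v) l u == j].

Lemma node_atP v l j : (j < subtree_size T v)%N ->
  node_at v l j \in subtree v /\ rank (subtree v) l (node_at v l j) = j.
Proof.
move=> jz; rewrite /node_at; case: pickP => [u /andP[? /eqP]//|no].
have [u uv ju] := @rank_surj (subtree v) l j jz.
by have := no u; rewrite uv ju eqxx.
Qed.

Lemma node_at_unique v l j u :
  u \in subtree v -> rank (subtree v) l u = j -> node_at v l j = u.
Proof.
move=> uv <-; have [|] := @node_atP v l (rank (subtree v) l u).
  exact: rank_lt.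
by move=> ? ?; apply: (@rank_inj (subtree v) l).
Qed.

Definition swap v j l : {perm V} := tperm (node_at v l j) (node_at v l j.+1).

Lemma swap_subtree v j l : (j.+1 < subtree_size T v)%N ->
  forall x, (swap v j l x \in subtree v) = (x \in subtree v).
Proof.
move=> jz x; have [a _] := node_atP l (ltnW jz); have [b _] := node_atP l jz.
by rewrite /swap; case: tpermP => [->|->|//]; rewrite a b.
Qed.

(** Since the two labels have consecutive ranks, no label of the subtree lies
    between them, so within the subtree at v only the comparison between their
    two owners changes. *)
Definition exchange v j l := relabel (swap v j l) l.

Lemma node_at_exchange v j l i : (j.+1 < subtree_size T v)%N ->
  (i < subtree_size T v)%N -> node_at v (exchange v j l) i = swap v j l (node_at v l i).
Proof.
move=> jz iz; have [a ia] := node_atP l iz.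
apply: node_at_unique; first by rewrite swap_subtree.
by rewrite rank_relabel ?tpermK //; exact: swap_subtree.
Qed.

(** The exchange interchanges the owners of the ranks j and j + 1, hence the
    transposition attached to the new labeling is the same one. *)
Lemma exchangeK v j : (j.+1 < subtree_size T v)%N -> involutive (exchange v j).
Proof.
move=> jz l; rewrite {1}/exchange.
have -> : swap v j (exchange v j l) = swap v j l.
  by rewrite {1}/swap !node_at_exchange ?(ltnW jz) // /swap tpermL tpermR tpermC.
by rewrite relabelK //; exact: tpermK.
Qed.

Lemma subtree_rank_exchange v j l : (j.+1 < subtree_size T v)%N ->
  subtree_rank l v = j -> subtree_rank (exchange v j l) v = j.+1.
Proof.
move=> jz jv; rewrite /subtree_rank rank_relabel; last exact: swap_subtree.
have vj : node_at v l j = v by apply: node_at_unique => //; exact: anc_le_refl.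
by rewrite /swap vj tpermL; exact: (node_atP l jz).2.
Qed.

Lemma subtree_rank_exchangeV v j l : (j.+1 < subtree_size T v)%N ->
  subtree_rank l v = j.+1 -> subtree_rank (exchange v j l) v = j.
Proof.
move=> jz jv; rewrite /subtree_rank rank_relabel; last exact: swap_subtree.
have vj : node_at v l j.+1 = v by apply: node_at_unique => //; exact: anc_le_refl.
by rewrite /swap vj tpermR; exact: (node_atP l (ltnW jz)).2.
Qed.

(** Transposing j and j + 1 preserves the order of all values once one of these
    two is excluded. *)
Lemma ltn_swap j r a b : (r == j) || (r == j.+1) -> a != r -> b != r ->
  ((if a == j then j.+1 else if a == j.+1 then j else a) <
   (if b == j then j.+1 else if b == j.+1 then j else b))%N = (a < b)%N.
Proof. by case: (a =P j); case: (b =P j); case: (a =P j.+1); case: (b =P j.+1); lia. Qed.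

(** The position of w decides.  If w is above v, the exchange permutes the nodes
    of the subtree at w and fixes w.  If w is incomparable to v, the two subtrees
    are disjoint.  If w is below v, the subtree at w misses v, and the other
    exchanged label keeps its order relative to all labels but that of v. *)
Lemma subtree_rank_exchange_other v j l w : (j.+1 < subtree_size T v)%N ->
  (subtree_rank l v == j) || (subtree_rank l v == j.+1) -> w != v ->
  subtree_rank (exchange v j l) w = subtree_rank l w.
Proof.
move=> jz jv wv.
have [a ja] := node_atP l (ltnW jz); have [b jb] := node_atP l jz.
have vv : v \in subtree v by exact: anc_le_refl.
case: (boolP (anc_le T w v)) => [lwv|nwv].
  have sub x : x \in subtree v -> x \in subtree w by exact: anc_le_trans.
  have sw : swap v j l w = w.
    have wN : w \notin subtree v by apply: contra wv => vw; rewrite (anc_le_anti lwv vw).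
    by rewrite /swap tpermD //; apply: contra wN => /eqP <-.
  rewrite /subtree_rank rank_relabel ?sw // => x.
  by rewrite /swap; case: tpermP => [->|->|//]; rewrite !sub.
suff cmp x : x \in subtree w ->
    (val (exchange v j l) x < val (exchange v j l) w)%N = (val l x < val l w)%N.
  apply: eq_card => x; rewrite !inE; case wx: (anc_le T w x) => //=.
  by rewrite cmp.
move=> wx; rewrite !relabelE.
have vx : x != v by apply: contraNneq nwv => <-.
case: (boolP (anc_le T v w)) => [lvw|nvw]; last first.
  have out y : y \in subtree w -> swap v j l y = y.
    move=> wy; have yN : y \notin subtree v.
      apply/negP => vy; have := anc_le_total (wy : anc_le T w y) (vy : anc_le T v y).
      by rewrite (negPf nwv) (negPf nvw).
    by rewrite /swap tpermD //; apply: contra yN => /eqP <-.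
  by rewrite !out //; exact: anc_le_refl.
have xv : x \in subtree v by exact: anc_le_trans lvw wx.
rewrite -!(@ltn_rank (subtree v)) ?swap_subtree //.
have rswap y : y \in subtree v -> rank (subtree v) l (swap v j l y) =
    if rank (subtree v) l y == j then j.+1 else
    if rank (subtree v) l y == j.+1 then j else rank (subtree v) l y.
  move=> vy; rewrite /swap; case: tpermP => [->|->|yj yj1].
  - by rewrite ja jb eqxx.
  - by rewrite ja jb eqxx gtn_eqF.
  - case: eqP => [/(node_at_unique vy)/esym//|_].
    by case: eqP => [/(node_at_unique vy)/esym//|_].
have neq y : y \in subtree v -> y != v -> rank (subtree v) l y != subtree_rank l v.
  by move=> vy; apply: contra_neq => /(rank_inj vy); exact.
move: jv (neq _ xv vx) (neq _ lvw wv); rewrite !rswap //.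
exact: ltn_swap.
Qed.

Lemma subtree_rank_lt l v : (subtree_rank l v < subtree_size T v)%N.
Proof. by apply: rank_lt; exact: anc_le_refl. Qed.

Variable F : numFieldType.

Definition blind v (g : labeling V -> F) : Prop :=
  forall l l', (forall w, w != v -> subtree_rank l w = subtree_rank l' w) ->
  g l = g l'.

(** The exchange is a bijection between the two ranges of summation, and g does
    not see it. *)
Lemma sum_subtree_rank_step v g j : blind v g -> (j.+1 < subtree_size T v)%N ->
  \sum_(l | subtree_rank l v == j.+1) g l = \sum_(l | subtree_rank l v == j) g l.
Proof.
move=> gv jz; rewrite (reindex_inj (inv_inj (exchangeK jz))) /=.
apply: eq_big => [l|l lj].
  apply/eqP/eqP => lj; last exact: subtree_rank_exchange.
  by rewrite -(exchangeK jz l); exact: subtree_rank_exchangeV.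
apply: gv => w wv; apply: subtree_rank_exchange_other => //.
by move/eqP: lj => /(subtree_rank_exchangeV jz); rewrite exchangeK // => ->; rewrite eqxx.
Qed.

(** One rank can be averaged out: all its possible values carry the same total
    weight of g. *)
Lemma sum_subtree_rank v (f : nat -> F) g : blind v g ->
  \sum_l f (subtree_rank l v) * g l =
  (\sum_(j < subtree_size T v) f j) / (subtree_size T v)%:R * \sum_l g l.
Proof.
move=> gv; set z := subtree_size T v; pose c := \sum_(l | subtree_rank l v == 0%N) g l.
have classE j : (j < z)%N -> \sum_(l | subtree_rank l v == j) g l = c.
  by elim: j => // j IH jz; rewrite sum_subtree_rank_step // IH // ltnW.
have split_rank (h : nat -> F) :
    \sum_l h (subtree_rank l v) * g l = (\sum_(j < z) h j) * c.
  rewrite (partition_big (fun l => Ordinal (subtree_rank_lt l v)) xpredT) //=.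
  rewrite mulr_suml; apply: eq_bigr => j _; rewrite -(classE j) // mulr_sumr.
  by apply: eq_big => [l|l /eqP <-].
have -> : \sum_l g l = z%:R * c.
  have := split_rank (fun=> 1); rewrite sumr_const card_ord => <-.
  by apply: eq_bigr => l _; rewrite mul1r.
rewrite split_rank -mulrA mulKf // pnatr_eq0 -lt0n.
by apply/card_gt0P; exists v; exact: anc_le_refl.
Qed.

(** Independence and uniformity of the subtree ranks, tested on products of
    functions of the single ranks; the ranks are averaged out one at a time. *)
Lemma subtree_ranks_independent (f : V -> nat -> F) :
  \sum_l \prod_v f v (subtree_rank l v) =
  #|{: labeling V}|%:R *
  \prod_v ((\sum_(j < subtree_size T v) f v j) / (subtree_size T v)%:R).
Proof.
suff partial (s : seq V) : uniq s ->
    \sum_l \prod_(v <- s) f v (subtree_rank l v) = #|{: labeling V}|%:R *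
    \prod_(v <- s) ((\sum_(j < subtree_size T v) f v j) / (subtree_size T v)%:R).
  exact/partial/index_enum_uniq.
elim: s => [|v s IH] /=.
  by under eq_bigr do rewrite big_nil; rewrite big_nil sumr_const mulr1.
move=> /andP[vs us]; under eq_bigr do rewrite big_cons.
rewrite sum_subtree_rank ?IH ?big_cons // 1?mulrCA // => l l' ll'.
apply: eq_big_seq => w ws; rewrite ll' //.
by apply: contraNneq vs => <-.
Qed.

End SubtreeRanks.

(** * Power series at the origin *)

Section PowerSeries.
Variable R : realType.
Implicit Types (c d : nat -> R) (f g : R -> R) (x t : R).

(** For |z| < r < |x| the extra factor i + 1 is absorbed by the geometric decay
    of q = |z| / r, as (i + 1) q^i <= 1 + q + ... + q^i <= 1 / (1 - q); what
    remains is the absolutely convergent series at r. *)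
Lemma is_cvg_pseries_diffs_inside c (x z : R) :
  cvgn (pseries c x) -> `|z| < `|x| -> cvgn (pseries (pseries_diffs c) z).
Proof.
move=> cx zx; pose r := (`|z| + `|x|) / 2.
have [zr rx] : `|z| < r /\ r < `|x| by rewrite /r; split; lra.
have r0 : 0 < r by exact: le_lt_trans zr.
pose q := `|z| / r.
have q0 : 0 <= q by rewrite divr_ge0 // ltW.
have q1 : q < 1 by rewrite ltr_pdivrMr // mul1r.
have powq i : i.+1%:R * q ^+ i <= (1 - q)^-1.
  rewrite -[leRHS]mul1r ler_pdivlMr ?subr_gt0 //.
  have : 1 - q ^+ i.+1 <= 1 by rewrite gerBl exprn_ge0.
  apply: le_trans; rewrite -[leRHS]opprB subrX1 -[leRHS]mulNr opprB mulrC.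
  rewrite ler_wpM2l ?subr_ge0 ?(ltW q1) //.
  rewrite mulr_natl -[i.+1 in leLHS]card_ord -sumr_const; apply: ler_sum => j _.
  by rewrite ler_wiXn2l ?(ltW q1) // -ltnS.
have cr : cvgn (pseries (fun i => `|c i|) r).
  by apply: is_cvg_pseries_inside_norm cx _; rewrite gtr0_norm.
apply: normed_cvg.
pose C := (1 - q)^-1 / r.
have C0 : 0 <= C by rewrite divr_ge0 ?invr_ge0 ?subr_ge0 // ltW.
apply: (@series_le_cvg _ _ (fun i => C * (`|c i.+1| * r ^+ i.+1))).
- by move=> i; exact: normr_ge0.
- move=> i; apply: mulr_ge0 => //; apply: mulr_ge0 => //; exact: exprn_ge0 (ltW r0).
- move=> i; rewrite /pseries_diffs /= !normrM normr_nat normrX.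
  have -> : `|z| ^+ i = q ^+ i * r ^+ i by rewrite -exprMn divfK // gt_eqF.
  have -> : C * (`|c i.+1| * r ^+ i.+1) = (1 - q)^-1 * (`|c i.+1| * r ^+ i).
    by rewrite /C exprS; field; rewrite (gt_eqF r0) subr_eq0 (gt_eqF q1).
  have -> : i.+1%:R * `|c i.+1| * (q ^+ i * r ^+ i) =
    (i.+1%:R * q ^+ i) * (`|c i.+1| * r ^+ i) by ring.
  by rewrite ler_wpM2r ?mulr_ge0 ?exprn_ge0 // ltW.
rewrite (_ : (fun i => _) = C *: (fun i => `|c i.+1| * r ^+ i.+1)) //.
apply: is_cvg_seriesZ.
have : cvgn (fun n => pseries (fun i => `|c i|) r n.+1).
  by apply/cvg_ex; exists (limn (pseries (fun i => `|c i|) r)); rewrite (cvg_shiftS (pseries _ r)).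
move=> H.
have -> : series (fun i => `|c i.+1| * r ^+ i.+1) =
  (fun n => pseries (fun i => `|c i|) r n.+1 - `|c 0%N|).
  apply/funext => n; rewrite /pseries /series /= [in RHS]big_nat_recl //=.
  by rewrite expr0 mulr1 addrC addKr.
by apply: is_cvgB => //; exact: is_cvg_cst.
Qed.

(** Only the germ of f at 0 matters, so no radius of convergence has to be
    carried along. *)
Definition has_pseries c f := \forall x \near (0 : R), pseries c x @ \oo --> f x.

(** Termwise differentiation.  The radii e/2, e/3 and e/4 leave room for the
    convergence of the series differentiated once and twice. *)
Lemma has_pseries_derive c f : has_pseries c f ->
  (\forall x \near (0 : R), is_derive (x : R) (1 : R) f (f^`()%classic x)) /\
  has_pseries (pseries_diffs c) (f^`()%classic).
Proof.
move=> [e /= e0 ce]; rewrite /ball_ /= in ce.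
have cf x : `|x| < e -> pseries c x @ \oo --> f x.
  by move=> xe; apply: ce; rewrite /= sub0r normrN.
have e2 : `|e / 2| < e by rewrite gtr0_norm ?divr_gt0 //; lra.
have c1 x : `|x| < e / 2 -> cvgn (pseries (pseries_diffs c) x).
  move=> xe; apply: (@is_cvg_pseries_diffs_inside _ (e / 2)).
    by apply/cvg_ex; exists (f (e / 2)); exact: cf.
  by rewrite (gtr0_norm (divr_gt0 _ _)).
have df x : `|x| < e / 4 -> is_derive x 1 f (limn (pseries (pseries_diffs c) x)).
  move=> xe; pose K := e / 4.
  have Ke : `|K| = K by rewrite gtr0_norm // divr_gt0.
  have K2 : K < e / 2 by rewrite /K; lra.
  have cK : cvgn (pseries c K) by apply/cvg_ex; exists (f K); apply: cf; rewrite Ke /K; lra.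
  have c3 : `|e / 3| = e / 3 by rewrite gtr0_norm // divr_gt0.
  have c2K : cvgn (pseries (pseries_diffs (pseries_diffs c)) K).
    by apply: (@is_cvg_pseries_diffs_inside _ (e / 3)); [apply: c1|]; rewrite ?Ke c3 /K; lra.
  have c1K : cvgn (pseries (pseries_diffs c) K) by apply: c1; rewrite Ke.
  have := pseries_snd_diffs cK c1K c2K; rewrite Ke => /(_ _ xe).
  apply: near_eq_is_derive.
  have xe1 : `|x| < e by apply: lt_trans xe _; rewrite /K; lra.
  near=> y; apply: cvg_lim => //; apply: cf; near: y.
  exact: (cvgr_norm_lt x cvg_id _ xe1).
have near4 : \forall x \near (0 : R), `|x| < e / 4 by apply: nbhs0_lt; rewrite divr_gt0.
split; near=> x.
  have xe : `|x| < e / 4 by near: x.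
  by have := df _ xe => dfx; rewrite derive1E (@derive_val _ _ _ _ _ _ _ dfx).
have xe : `|x| < e / 4 by near: x.
have := df _ xe => dfx; rewrite derive1E (@derive_val _ _ _ _ _ _ _ dfx).
by apply: c1; lra.
Unshelve. all: by end_near. Qed.

Lemma pseries0 c : pseries c 0 @ \oo --> c 0%N.
Proof.
rewrite -(cvg_shiftS (pseries c 0)).
rewrite (_ : (fun n => _) = (fun=> c 0%N)); first exact: cvg_cst.
apply/funext => n; rewrite /pseries /series /= big_nat_recl //= expr0 mulr1.
by rewrite big1 ?addr0 // => i _; rewrite exprS mul0r mulr0.
Qed.

(** Taylor's formula for the coefficients: differentiate termwise n times and
    evaluate at 0. *)
Lemma has_pseries_derive1n c f n : has_pseries c f ->
  (f^`(n))%classic 0 = n`!%:R * c n.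
Proof.
move=> cf.
have cn : has_pseries (iter n (@pseries_diffs R) c) (f^`(n))%classic.
  elim: n => // n IH; rewrite derive1nS iterS.
  exact: (has_pseries_derive IH).2.
have -> : n`!%:R * c n = iter n (@pseries_diffs R) c 0%N.
  suff -> : forall j, iter n (@pseries_diffs R) c j = ((j + n) ^_ n)%:R * c (j + n)%N.
    by rewrite add0n ffactnn.
  elim: {cn} n => [|n IH] j; first by rewrite ffactn0 mul1r addn0.
  by rewrite iterS /pseries_diffs IH mulrA -natrM -addSnnS ffactnSr addnK mulnC.
apply: (cvg_unique _ _ (@pseries0 _)) => //.
exact: nbhs_singleton cn.
Qed.

Lemma pseriesD c d x : pseries (c + d) x = pseries c x + pseries d x.
Proof.
apply/funext => n; rewrite -[RHS]/(pseries c x n + pseries d x n).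
rewrite /pseries /series /= -big_split /=.
by apply: eq_bigr => i _; rewrite mulrDl.
Qed.

Lemma has_pseriesD c d f g : has_pseries c f -> has_pseries d g ->
  has_pseries (c + d) (f + g).
Proof.
move=> cf dg; near=> x; rewrite pseriesD.
by apply: cvgD; near: x.
Unshelve. all: by end_near. Qed.

Lemma has_pseries0 : has_pseries 0 0.
Proof.
near=> x; rewrite (_ : pseries 0 x = fun=> 0); first exact: cvg_cst.
by apply/funext => n; rewrite /pseries /series /= big1 // => i _; rewrite mul0r.
Unshelve. all: by end_near. Qed.

Lemma has_pseries_sum (I : Type) (r : seq I) (c : I -> nat -> R) (f : I -> R -> R) :
  (forall i, has_pseries (c i) (f i)) ->
  has_pseries (\sum_(i <- r) c i) (\sum_(i <- r) f i).
Proof.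
by move=> cf; apply: big_ind2 => [|? ? ? ?|//]; [exact: has_pseries0|exact: has_pseriesD].
Qed.

Lemma has_pseries_scale a c f : has_pseries c f ->
  has_pseries (fun n => a ^+ n * c n) (fun x => f (a * x)).
Proof.
move=> cf.
have ax : a * x @[x --> (0 : R)] --> (0 : R).
  by rewrite -[X in _ --> X](mulr0 a); apply: cvgMl_tmp; exact: cvg_id.
near=> x; rewrite (_ : pseries _ x = pseries c (a * x)).
  by near: x; exact: (ax _ cf).
apply/funext => n; rewrite /pseries /series /=.
by apply: eq_bigr => i _; rewrite exprMn; ring.
Unshelve. all: by end_near.
Qed.

Lemma has_pseriesN c f : has_pseries c f -> has_pseries (- c) (- f).
Proof.
move=> cf; near=> x.
rewrite (_ : pseries (- c) x = - pseries c x); first by apply: cvgN; near: x.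
apply/funext => n; rewrite -[RHS]/(- pseries c x n) /pseries /series /= -sumrN.
by apply: eq_bigr => i _; rewrite mulNr.
Unshelve. all: by end_near. Qed.

Lemma has_pseriesX : has_pseries (fun n => (n == 1%N)%:R) id.
Proof.
near=> x.
suff ser n : pseries (fun n => (n == 1%N)%:R) x n.+2 = x.
  by rewrite -(cvg_shiftS (pseries _ _)) -(cvg_shiftS (fun n => _)) /=;
     under eq_fun do rewrite ser; exact: cvg_cst.
rewrite /pseries /series /= !big_nat_recl // mul0r mul1r expr1 add0r.
by rewrite big1 ?addr0 // => i _; rewrite mul0r.
Unshelve. all: by end_near. Qed.

Lemma near_eq_has_pseries c f g : (\forall x \near (0 : R), f x = g x) ->
  has_pseries c f -> has_pseries c g.
Proof.
by move=> fg cf; near=> x; rewrite -(near fg x) //; near: x.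
Unshelve. all: by end_near. Qed.

Lemma has_pseries_unique c d f : has_pseries c f -> has_pseries d f -> c = d.
Proof.
move=> cf df; apply/funext => n.
have := has_pseries_derive1n n cf; rewrite (has_pseries_derive1n n df).
by move/mulfI => -> //; rewrite pnatr_eq0 -lt0n fact_gt0.
Qed.

Lemma has_pseries_continuous c f : has_pseries c f -> {for 0, continuous f}.
Proof.
move=> /has_pseries_derive[/nbhs_singleton df _].
by apply: differentiable_continuous; apply/derivable1_diffP.
Qed.

(** By the mean value theorem on the interval between 0 and x, which takes the
    derivative inside the interval and continuity at its endpoint 0. *)
Lemma near_0_constant f : {for 0, continuous f} ->
  (\forall x \near (0 : R)^', is_derive (x : R) (1 : R) f 0) ->
  \forall x \near (0 : R), f x = f 0.
Proof.
move=> f0 [e /= e0 fe].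
have df x : `|x| < e -> x != 0 -> is_derive x 1 f 0.
  by move=> xe x0; apply: fe => //=; rewrite sub0r normrN.
have cf x : `|x| < e -> {for x, continuous f}.
  move=> xe; have [->//|x0] := eqVneq x 0.
  by have [dfx _] := df _ xe x0; apply: differentiable_continuous; apply/derivable1_diffP.
have cst a b : a < b -> (forall x, x \in `[a, b] -> `|x| < e) ->
    (forall x, x \in `]a, b[ -> x != 0) -> f a = f b.
  move=> ab abe ab0; have [||z _ /eqP] := @MVT R f (fun=> 0) a b ab.
  - move=> x xab; apply: df; last exact: ab0.
    by apply: abe; move: xab; rewrite !in_itv /= => /andP[/ltW -> /ltW ->].
  - apply: continuous_in_subspaceT => x /set_mem /= xab.
    exact/cf/abe.
  - by rewrite mul0r subr_eq0 => /eqP.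
have near_e : \forall x \near (0 : R), `|x| < e by exact: nbhs0_lt.
near=> x; have xe : `|x| < e by near: x.
have [x0|x0|->//] := ltgtP x 0.
- apply: cst => // y; rewrite in_itv /= => /andP[xy y0].
    by move: xe; rewrite !ler0_norm //; lra.
  by rewrite lt_eqF.
- apply/esym/cst => // y; rewrite in_itv /= => /andP[xy y0].
    by move: xe; rewrite !ger0_norm //; lra.
  by rewrite gt_eqF.
Unshelve. all: by end_near. Qed.

(** Dividing the coefficients by n integrates (g x - d 0) / x; the constant term
    disappears since d 0 / 0 = 0.  This produces the expansion of a function f
    from one of x f'(x). *)
Lemma has_pseries_antiderivative d g : has_pseries d g ->
  exists G, [/\ has_pseries (fun n => d n / n%:R) G, G 0 = 0 &
    \forall x \near (0 : R)^', is_derive (x : R) (1 : R) G ((g x - d 0%N) / x)].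
Proof.
move=> [e /= e0 de].
pose l n := d n / n%:R.
have dg x : `|x| < e -> pseries d x @ \oo --> g x.
  by move=> xe; apply: de; rewrite /= sub0r normrN.
have lG : has_pseries l (fun x => limn (pseries l x)).
  have near_e : \forall x \near (0 : R), `|x| < e / 2 by apply: nbhs0_lt; rewrite divr_gt0.
  near=> x; have xe : `|x| < e / 2 by near: x.
  suff : cvgn (pseries l x) by [].
  apply: normed_cvg.
  apply: (@series_le_cvg _ _ (fun n => `|d n| * `|x| ^+ n)).
  - by move=> n; exact: normr_ge0.
  - by move=> n; rewrite mulr_ge0 // exprn_ge0.
  - move=> n /=; rewrite !normrM normrX ler_wpM2r ?exprn_ge0 //.
    rewrite ler_piMr // normfV normr_nat; case: n => [|n]; first by rewrite invr0.
    by rewrite invf_le1 ?ltr0n ?ler1n.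
  - apply: (@is_cvg_pseries_inside_norm _ _ (e / 2)).
      by apply/cvg_ex; exists (g (e / 2)); apply: dg; rewrite gtr0_norm ?divr_gt0 //; lra.
    by rewrite normr_id (gtr0_norm (divr_gt0 _ _)).
exists (fun x => limn (pseries l x)); split=> //.
  by apply: cvg_lim => //; rewrite -[X in _ --> X](mulr0 (d 0%N)) -[X in _ * X]invr0; exact: pseries0.
have [lD lD'] := has_pseries_derive lG.
have near_e : \forall x \near (0 : R)^', `|x| < e by exact: dnbhs0_lt.
near=> x; have x0 : x != 0 by near: x; exact: nbhs_dnbhs_neq.
rewrite -[_ / x](_ : (fun x => limn (pseries l x))^`()%classic x = _).
  by near: x; exact: nbhs_dnbhs.
apply: (canRL (mulfK x0)); apply/eqP; rewrite eq_sym subr_eq; apply/eqP.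
have to_g : pseries d x @ \oo --> g x by apply: dg; near: x.
apply: (cvg_unique _ to_g) => //=; rewrite -(cvg_shiftS (pseries d x)).
rewrite (_ : (fun n => _) = (fun n => pseries (pseries_diffs l) x n * x + d 0%N)).
  apply: cvgD; last exact: cvg_cst.
  by apply: cvgMr_tmp; near: x; exact: nbhs_dnbhs.
apply/funext => n; rewrite /pseries /series /= big_nat_recl //= expr0 mulr1 addrC.
congr (_ + _); rewrite mulr_suml; apply: eq_bigr => i _.
by rewrite /pseries_diffs /l exprSr mulrA [_.+1%:R * _]mulrC divfK.
Unshelve. all: by end_near. Qed.

End PowerSeries.

(** * The Bernoulli numbers and the logarithm of (e^x - 1) / x *)

Section Bernoulli.
Variable R : realType.
Implicit Types (x t : R) (n : nat).

Definition bernoulli_coeff n : R := bernoulli R n / n`!%:R.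

(** The value at 0 is the one that the power series takes there; that it is the
    limit 1 is the content of bernoulli_coeff0. *)
Definition bernoulli_fun x : R :=
  if x == 0 then bernoulli_coeff 0 else x / (expR x - 1).

Lemma expR_sub1_neq0 x : x != 0 -> expR x - 1 != 0.
Proof. by move=> x0; rewrite subr_eq0 -expR0 (inj_eq (@expR_inj R)). Qed.

Lemma has_pseries_bernoulli : has_pseries bernoulli_coeff bernoulli_fun.
Proof.
have := @bernoulliP R; rewrite /bernoulli_egf /has_pseries => near_B.
have : \forall x \near (0 : R), x != 0 ->
    pseries bernoulli_coeff x @ \oo --> x / (expR x - 1).
  exact: near_B.
apply: filterS => x xB; rewrite /bernoulli_fun; have [->|x0] := eqVneq x 0.
  exact: pseries0.
exact: xB.
Qed.

(** The continuous extension to 0. *)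
Definition exp_quotient x : R := if x == 0 then 1 else (expR x - 1) / x.

Lemma exp_quotient_gt0 x : 0 < exp_quotient x.
Proof.
rewrite /exp_quotient; case: (ltgtP x 0) => // x0.
  by rewrite nmulr_rgt0 ?invr_lt0 // subr_lt0 expR_lt1.
by rewrite divr_gt0 // subr_gt0 expR_gt1.
Qed.

Lemma cvg_exp_quotient : (expR x - 1) / x @[x --> (0 : R)^'] --> (1 : R).
Proof.
have [de] := is_derive_expR (0 : R); rewrite expR0 => val.
rewrite -[X in _ --> X]val; have := de; apply: cvg_trans; apply: near_eq_cvg.
near=> x; rewrite /= addr0 [_ *: 1]mulr1 expR0 -[_ *: _]/(_ * _) mulrC.
Unshelve. all: by end_near. Qed.

Lemma continuous_exp_quotient : {for 0, continuous exp_quotient}.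
Proof.
apply/continuous_withinNx; rewrite [exp_quotient 0]/exp_quotient eqxx.
have : (expR x - 1) / x @[x --> (0 : R)^'] --> (1 : R) by exact: cvg_exp_quotient.
apply: cvg_trans; apply: near_eq_cvg; near=> x.
by rewrite /exp_quotient ifN //; near: x; exact: nbhs_dnbhs_neq.
Unshelve. all: by end_near. Qed.

Lemma bernoulli_coeff0 : bernoulli_coeff 0 = 1.
Proof.
have /continuous_withinNx := has_pseries_continuous has_pseries_bernoulli.
rewrite {2}/bernoulli_fun eqxx => cvgB.
suff cvg1 : bernoulli_fun x @[x --> (0 : R)^'] --> (1 : R) by exact: (cvg_unique _ cvgB cvg1).
have : ((expR x - 1) / x)^-1 @[x --> (0 : R)^'] --> (1 : R).
  by rewrite -[X in _ --> X]invr1; apply: cvgV; [exact: oner_neq0 | exact: cvg_exp_quotient].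
apply: cvg_trans; apply: near_eq_cvg; near=> x.
have x0 : x != 0 by near: x; exact: nbhs_dnbhs_neq.
by rewrite /bernoulli_fun (negPf x0) invf_div.
Unshelve. all: by end_near. Qed.

(** Comparison of coefficients in the identity
    (-x) / (e^(-x) - 1) = x / (e^x - 1) + x. *)
Lemma bernoulli_coeff_reflect n :
  (-1) ^+ n * bernoulli_coeff n = bernoulli_coeff n + (n == 1%N)%:R.
Proof.
have sym : has_pseries (fun n => (-1) ^+ n * bernoulli_coeff n) (bernoulli_fun + id).
  apply: near_eq_has_pseries (has_pseries_scale (-1) has_pseries_bernoulli).
  near=> x; rewrite -[RHS]/(bernoulli_fun x + x) /bernoulli_fun mulN1r oppr_eq0.
  have [->|x0] := eqVneq x 0; first by rewrite addr0.
  have E1 := expR_sub1_neq0 x0; have EN1 : expR (- x) - 1 != 0.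
    by apply: expR_sub1_neq0; rewrite oppr_eq0.
  rewrite expRN in EN1 *; have E0 := expR_gt0 x; field.
  by rewrite E1 (gt_eqF E0) /= mulN1r -oppr_eq0 opprD opprK addrC E1.
have := has_pseries_unique sym (has_pseriesD has_pseries_bernoulli (@has_pseriesX R)).
by move=> /(congr1 (fun c => c n)).
Unshelve. all: by end_near. Qed.

Lemma bernoulli_coeff1 : bernoulli_coeff 1 = - 2^-1.
Proof. by have := bernoulli_coeff_reflect 1; rewrite expr1 eqxx /=; lra. Qed.

Lemma bernoulli_odd n : (1 < n)%N -> odd n -> bernoulli R n = 0.
Proof.
move=> n1 on; have := bernoulli_coeff_reflect n.
rewrite -signr_odd on gtn_eqF // expr1 addr0 /bernoulli_coeff mulN1r => /eqP.
rewrite eq_sym -subr_eq0 opprK -mulr2n mulrn_eq0 /= mulf_eq0 invr_eq0.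
by rewrite pnatr_eq0 -leqn0 leqNgt fact_gt0 orbF => /eqP.
Qed.

(** B_n / (n n!), corrected at n = 1, where B_1 / 1 = -1/2 becomes 1/2; at n = 0
    the division by 0 gives 0 = ln 1, the right constant term. *)
Definition log_exp_coeff n : R := (bernoulli_coeff n + (n == 1%N)%:R) / n%:R.

(** Let f be the logarithm.  Then x f'(x) = x / (e^x - 1) + x - 1 for x != 0, so
    f has the same derivative near 0 as the antiderivative G of the Bernoulli
    series; both are continuous at 0 and vanish there. *)
Lemma has_pseries_ln_exp_quotient :
  has_pseries log_exp_coeff (fun x => ln (exp_quotient x)).
Proof.
have sB := has_pseriesD has_pseries_bernoulli (@has_pseriesX R).
have [G [sG G0 dG]] := has_pseries_antiderivative sB.
have diff0 : \forall x \near (0 : R),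
    (@ln R \o exp_quotient - G) x = (@ln R \o exp_quotient - G) 0.
  apply: near_0_constant.
    apply: (@continuousB _ _ _ (@ln R \o exp_quotient) G); last exact: has_pseries_continuous sG.
    apply: continuous_comp; first exact: continuous_exp_quotient.
    exact/continuous_ln/exp_quotient_gt0.
  near=> x; have x0 : x != 0 by near: x; exact: nbhs_dnbhs_neq.
  have dGx : is_derive x 1 G (((bernoulli_fun + id) x -
    (bernoulli_coeff + (fun n => (n == 1%N)%:R)) 0%N) / x) by near: x.
  have dq : is_derive x 1 exp_quotient ((expR x * x - (expR x - 1)) / x ^+ 2).
    have qE : \forall y \near x, (expR y - 1) * y^-1 = exp_quotient y.
      by near=> y; rewrite /exp_quotient ifN //; near: y; exact: open_neq.
    apply: near_eq_is_derive qE _.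
    have dE := is_deriveB (is_derive_expR x) (is_derive_cst (1 : R) x 1).
    have dV := @is_deriveV _ id x 1 1 x0 (is_derive_id x 1).
    apply: is_derive_eq (is_deriveM dE dV) _.
    rewrite -[(expR - cst 1) x]/(expR x - 1).
    by rewrite subr0 -![_ *: _]/(_ * _) /=; field.
  have := is_derive1_comp (is_derive1_ln (exp_quotient_gt0 x)) dq => dl.
  apply: is_derive_eq (is_deriveB dl dGx) _.
  rewrite -[(_ + id) x]/(bernoulli_fun x + x) -[(_ + _) 0%N]/(bernoulli_coeff 0 + 0).
  rewrite /exp_quotient /bernoulli_fun (negPf x0) bernoulli_coeff0.
  by field; rewrite x0 expR_sub1_neq0.
apply: near_eq_has_pseries sG; near=> x.
have : (@ln R \o exp_quotient - G) x = (@ln R \o exp_quotient - G) 0 by near: x.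
rewrite -[LHS]/(ln (exp_quotient x) - G x) -[RHS]/(ln (exp_quotient 0) - G 0).
by rewrite G0 {2}/exp_quotient eqxx ln1 subrr => /eqP; rewrite subr_eq0 => /eqP.
Unshelve. all: by end_near. Qed.

End Bernoulli.

(** * The logarithm of a finite average of exponentials *)

Section FiniteAverage.
Variables (R : realType) (I : finType) (x : I -> R).
Hypothesis I_gt0 : (0 < #|I|)%N.

Let E (k : nat) (t : R) : R := \sum_i x i ^+ k * expR (x i * t).

Let is_derive_E k (t : R) : is_derive t (1 : R) (E k) (E k.+1 t).
Proof.
have -> : E k = \sum_i (fun s => x i ^+ k * expR (x i * s)).
  by apply/funext => s; rewrite fct_sumE.
apply: (@big_ind2 _ _ (fun (f : R -> R) df => is_derive t 1 f df)) => [|f df g dg|i _].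
- exact: is_derive_cst.
- exact: is_deriveD.
have dx : is_derive t 1 (fun s => x i * s) (x i).
  by apply: is_derive_eq (is_deriveZ (x i) (is_derive_id t 1)) _; rewrite -[_ *: _]/(_ * _) mulr1.
have de := is_derive1_comp (is_derive_expR (x i * t)) dx.
apply: is_derive_eq (is_deriveZ (x i ^+ k) de) _.
by rewrite -[_ *: _]/(_ * _) exprS; ring.
Qed.

Definition avg (g : I -> R) : R := #|I|%:R^-1 * \sum_i g i.

Definition log_mgf t : R := ln (avg (fun i => expR (x i * t))).

Let E0_gt0 t : 0 < E 0 t.
Proof.
have /card_gt0P[i0 _] := I_gt0.
rewrite /E (bigD1 i0) //= expr0 mul1r ltr_pwDl ?expR_gt0 //.
by apply: sumr_ge0 => i _; rewrite expr0 mul1r expR_ge0.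
Qed.

Let derive1_log_mgf : log_mgf^`()%classic = (fun t => E 1 t / E 0 t).
Proof.
have N0 : 0 < #|I|%:R^-1 :> R by rewrite invr_gt0 ltr0n.
apply/funext => t; rewrite derive1E; apply: derive_val.
have -> : log_mgf = @ln R \o (fun s => #|I|%:R^-1 * E 0 s).
  by apply/funext => s; congr (ln (_ * _)); apply: eq_bigr => i _; rewrite expr0 mul1r.
have dE := is_deriveZ (#|I|%:R^-1 : R) (is_derive_E 0 t).
apply: is_derive_eq (is_derive1_comp (is_derive1_ln _) dE) _.
  by rewrite mulr_gt0.
rewrite -[_ *: _]/(_ * _) /= -[X in X^-1 * _]/(#|I|%:R^-1 * E 0 t).
by field; rewrite !gt_eqF // ltr0n.
Qed.

(** The first two cumulants are the mean and the variance: with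
    E k = \sum_i x_i^k e^(x_i t), the derivative of ln (E 0 / #|I|) is E 1 / E 0,
    and that of E 1 / E 0 is E 2 / E 0 - (E 1 / E 0)^2. *)
Lemma log_mgf_derive1 : log_mgf^`(1)%classic 0 = avg x.
Proof.
rewrite derive1n1 derive1_log_mgf mulrC /avg; congr (_^-1 * _).
  by rewrite -sumr_const; apply: eq_bigr => i _; rewrite mulr0 expR0 mulr1 expr0.
by apply: eq_bigr => i _; rewrite mulr0 expR0 mulr1 expr1.
Qed.

Lemma log_mgf_derive2 : log_mgf^`(2)%classic 0 = avg (fun i => (x i - avg x) ^+ 2).
Proof.
have E0 k : E k 0 = \sum_i x i ^+ k.
  by apply: eq_bigr => i _; rewrite mulr0 expR0 mulr1.
have N0 : #|I|%:R != 0 :> R by rewrite pnatr_eq0 -lt0n.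
have EN : E 0 0 = #|I|%:R by rewrite E0 -sumr_const; apply: eq_bigr.
rewrite derive1nS derive1n1 derive1_log_mgf derive1E.
have dV := is_deriveV (lt0r_neq0 (E0_gt0 0)) (is_derive_E 0 0).
rewrite (@derive_val _ _ _ _ _ _ _ (is_deriveM (is_derive_E 1 0) dV)).
rewrite -![_ *: _]/(_ * _) /avg EN.
have E1 : \sum_i x i = E 1 0 by rewrite E0.
under [in RHS]eq_bigr do rewrite sqrrB.
rewrite big_split sumrB /= -E0 sumr_const E1 -[_ *+ #|I|]mulr_natl.
under [in RHS]eq_bigr do rewrite -mulr_natl mulrA.
rewrite -mulr_suml -mulr_sumr E1.
by field.
Qed.

End FiniteAverage.

(** * The uniform law on an initial segment of the integers *)

Section UniformMgf.
Variable R : realType.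
Implicit Types (x y a t : R) (z : nat).

(** A geometric sum; the convention exp_quotient 0 = 1 covers t = 0. *)
Lemma uniform_mgfE z t : (0 < z)%N ->
  (\sum_(j < z) expR (j%:R * t)) / z%:R = exp_quotient (z%:R * t) / exp_quotient t.
Proof.
move=> z0; have zN : z%:R != 0 :> R by rewrite pnatr_eq0 -lt0n.
rewrite /exp_quotient mulf_eq0 (negPf zN) /=; case: (eqVneq t 0) => [->|t0].
  under eq_bigr do rewrite mulr0 expR0.
  by rewrite sumr_const card_ord divff // divr1.
under eq_bigr do rewrite expRM_natl.
have E1 := expR_sub1_neq0 t0.
apply: (mulfI E1); rewrite mulrA -subrX1 -expRM_natl.
by field; rewrite zN t0 E1.
Qed.

(** The log moment generating function of a fair coin with values 0 and 1 is
    f(2 t) - f(t), where f(x) = ln ((e^x - 1) / x).  Its second derivative at 0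
    is (2^2 - 1) B_2 / 2, and it is also the variance 1/4. *)
Lemma bernoulli2 : bernoulli R 2 = 6^-1.
Proof.
have sL := @has_pseries_ln_exp_quotient R.
have := has_pseries_derive1n 2 (has_pseriesD (has_pseries_scale 2 sL) (has_pseriesN sL)).
have -> : (fun t : R => ln (exp_quotient (2 * t))) + - (fun t => ln (exp_quotient t)) =
  log_mgf (fun j : 'I_2 => j%:R).
  apply/funext => t; rewrite -[LHS]/(ln (exp_quotient (2 * t)) - ln (exp_quotient t)).
  rewrite -ln_div ?posrE ?exp_quotient_gt0 // -uniform_mgfE // /log_mgf /avg.
  by rewrite card_ord mulrC.
rewrite log_mgf_derive2 ?card_ord // /avg card_ord !big_ord_recl !big_ord0 /=.
rewrite -[(_ + _) 2%N]/(_ ^+ 2 * log_exp_coeff R 2 - log_exp_coeff R 2).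
rewrite /log_exp_coeff /bernoulli_coeff /= addr0 !factS fact0 /bump /=.
by lra.
Qed.

(** cosh x <= exp (x^2 / 2), by comparing the power series term by term:
    x^(2 n) / (2 n)! <= (x^2 / 2)^n / n!, because 2^n n! <= (2 n)!. *)
Lemma expRDN_le x : expR x + expR (- x) <= 2 * expR (x ^+ 2 / 2).
Proof.
have cv y : series (exp_coeff y) n @[n --> \oo] --> expR y by exact: is_cvg_series_exp_coeff.
have cv2 y : series (exp_coeff y) (2 * n)%N @[n --> \oo] --> expR y.
  exact: (cvg_comp _ _ (@cvg_mulnl 2 isT) (cv y)).
have cvD : series (exp_coeff x) (2 * n)%N + series (exp_coeff (- x)) (2 * n)%N
    @[n --> \oo] --> expR x + expR (- x) by exact: cvgD.
apply: (ler_cvg_to cvD (cvgMl_tmp (cv (x ^+ 2 / 2)))).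
have fact2 n : (2 ^ n * n`! <= (2 * n)`!)%N.
  elim: n => // n IH; rewrite mulnS !factS expnS.
  rewrite mulnACA; apply: leq_mul; first by lia.
  by apply: leq_trans IH _; rewrite leq_pmull.
apply: nearW => n; rewrite /series /= !big_mkord.
elim: n => [|n IH]; first by rewrite muln0 !big_ord0 mulr0 addr0.
rewrite mulnS !big_ord_recr /= mulrDr.
rewrite /exp_coeff /= !(exprS _ (2 * n)) [(- x) ^+ _]exprM sqrrN -exprM.
have -> : forall a b c d e : R, a + b + x * c / e + (d + b + - x * c / e) = a + d + 2 * b.
  by move=> *; ring.
apply: lerD => //; rewrite ler_wpM2l // expr_div_n -exprM -mulrA.
rewrite ler_wpM2l //; first by rewrite exprM exprn_ge0 // sqr_ge0.
rewrite -invfM lef_pV2 ?posrE ?ltr0n ?fact_gt0 //.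
by rewrite -natrX -natrM ler_nat fact2.
Qed.

(** Monotonicity of cosh in the absolute value of its argument, from
    e^a + e^(-a) - e^y - e^(-y) = (e^a - e^y) (1 - e^(-a - y)). *)
Lemma expRDN_homo y a : `|y| <= a -> expR y + expR (- y) <= expR a + expR (- a).
Proof.
rewrite ler_norml => /andP[ay ya]; rewrite -subr_ge0.
have -> : expR a + expR (- a) - (expR y + expR (- y)) =
    (expR a - expR y) * (1 - expR (- a - y)).
  rewrite mulrBr mulr1 mulrBl -!expRD (_ : a + (- a - y) = - y); last by ring.
  by rewrite (_ : y + (- a - y) = - a); ring.
rewrite mulr_ge0 // subr_ge0 ?ler_expR // -(expR0 R) ler_expR; lra.
Qed.

(** The uniform law on {0, ..., z - 1} is symmetric about (z - 1) / 2, so pairing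
    j with z - 1 - j turns the centred moment generating function into an
    average of values of cosh. *)
Lemma uniform_mgf_le z t : (0 < z)%N ->
  expR (- (t * ((z%:R - 1) / 2))) * ((\sum_(j < z) expR (j%:R * t)) / z%:R) <=
  expR (8^-1 * t ^+ 2 * (z%:R - 1) ^+ 2).
Proof.
move=> z0; have zN : 0 < z%:R :> R by rewrite ltr0n.
rewrite mulrA ler_pdivrMr //.
pose y (j : 'I_z) := j%:R * t - t * ((z%:R - 1) / 2).
have -> : expR (- (t * ((z%:R - 1) / 2))) * \sum_(j < z) expR (j%:R * t) = \sum_j expR (y j).
  by rewrite mulr_sumr; apply: eq_bigr => j _; rewrite -expRD addrC.
have yN j : y (rev_ord j) = - y j.
  by rewrite /y /= natrB // -natr1; field.
have -> : \sum_j expR (y j) = \sum_j (expR (y j) + expR (- y j)) / 2.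
  rewrite -mulr_suml big_split /= [X in _ + X](_ : _ = \sum_j expR (y j)); first by field.
  by rewrite [RHS](reindex_inj rev_ord_inj); apply: eq_bigr => j _; rewrite yN.
set B := (X in _ <= X * _).
rewrite mulr_natr -[z in leRHS]card_ord -sumr_const; apply: ler_sum => j _.
rewrite ler_pdivrMr // mulrC {}/B.
have -> : 8^-1 * t ^+ 2 * (z%:R - 1) ^+ 2 = (`|t| * ((z%:R - 1) / 2)) ^+ 2 / 2.
  by rewrite exprMn real_normK ?num_real //; field.
apply: le_trans (expRDN_le _); apply: expRDN_homo.
rewrite /y [_ * t]mulrC -mulrBr normrM ler_wpM2l // ler_norml.
have j1 : (j.+1%:R <= z%:R :> R) by rewrite ler_nat.
have j0 : (0 <= j%:R :> R) by [].
by rewrite -natr1 in j1; apply/andP; split; lra.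
Qed.

End UniformMgf.

(** * The inversion number of a random labeling *)

Section UniformLabeling.
Context d (Omega : measurableType d) (R : realType) (P : probability Omega R).
Variables (V : finType) (T : rooted_tree V) (lam : Omega -> labeling V).
Hypothesis lam_unif : uniform_labeling P lam.

Lemma card_labeling_gt0 : (0 < #|{: labeling V}|)%N.
Proof.
have inj : injectiveb [ffun v : V => enum_rank v].
  by apply/injectiveP => u v; rewrite !ffunE; exact: enum_rank_inj.
by apply/card_gt0P; exists (exist (fun f : {ffun V -> 'I_#|V|} => injectiveb f) _ inj).
Qed.

(** A function of lam is a finite combination of the indicators of the events
    lam = l, each of the same probability. *)
Lemma expectation_uniform_labeling (g : labeling V -> R) :
  ('E_P[(fun w => g (lam w))] = (avg g)%:E)%E.
Proof.
rewrite unlock.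
have ind w : (g (lam w))%:E =
    (\sum_(l : labeling V) (g l)%:E * (\1_(lam @^-1` [set l]) w)%:E)%E.
  rewrite (bigD1 (lam w)) //= indicE mem_set // mule1 big1 ?adde0 // => l lw.
  by rewrite indicE memNset ?mule0 // => /= wl; rewrite wl eqxx in lw.
under eq_integral do rewrite ind.
have ml l := (lam_unif l).1.
have intl l := integrable_indic P (ml l).
rewrite integral_sum //; last by move=> l; exact: integrableZl.
have Pl l : (\int[P]_w ((\1_(lam @^-1` [set l]) w : R)%:E) =
    (#|{: labeling V}|%:R^-1)%:E)%E.
  by rewrite integral_indic // setIT; exact: (lam_unif l).2.
under eq_bigr do rewrite integralZl // Pl -EFinM.
by rewrite sumEFin -mulr_suml mulrC.
Qed.

Let I : Omega -> R := inversion_number R T lam.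
Let inv (l : labeling V) : R := (inversions T l)%:R.

Lemma mgf_inversions t : ('M_P I t = (avg (fun l => expR (inv l * t)))%:E)%E.
Proof. exact: expectation_uniform_labeling. Qed.

Lemma cumulantE k : cumulant P I k = ((log_mgf inv)^`(k))%classic 0.
Proof.
rewrite /cumulant; congr (derive1n k _ 0); apply/funext => t.
by rewrite mgf_inversions.
Qed.

End UniformLabeling.

Section TreeMgf.
Variables (R : realType) (V : finType) (T : rooted_tree V).
Let inv (l : labeling V) : R := (inversions T l)%:R.

Lemma subtree_size_gt0 v : (0 < subtree_size T v)%N.
Proof. by apply/card_gt0P; exists v; exact: anc_le_refl. Qed.

(** The inversion number is the sum of the subtree ranks, so its exponential is
    a product over the nodes, and the average factors. *)
Lemma avg_expR_inversions t :
  avg (fun l => expR (inv l * t)) =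
  \prod_v ((\sum_(j < subtree_size T v) expR (j%:R * t)) / (subtree_size T v)%:R).
Proof.
have N0 : #|{: labeling V}|%:R != 0 :> R by rewrite pnatr_eq0 -lt0n card_labeling_gt0.
apply: (canLR (mulKf N0)).
rewrite -(subtree_ranks_independent T (fun _ j => expR (j%:R * t))).
apply: eq_bigr => l _; rewrite /inv (inversions_rank T l) natr_sum mulr_suml.
exact: expR_sum.
Qed.

Lemma log_mgf_inversions :
  log_mgf inv = \sum_(v : V) ((fun t => ln (exp_quotient ((subtree_size T v)%:R * t))) -
                              (fun t => ln (exp_quotient t))).
Proof.
apply/funext => t; rewrite /log_mgf avg_expR_inversions fct_sumE.
under eq_bigr do rewrite uniform_mgfE ?subtree_size_gt0 //.
pose p v := exp_quotient ((subtree_size T v)%:R * t) / exp_quotient t.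
(* ln is multiplicative on positive reals only, so positivity of the partial
   products is carried through the induction. *)
apply: (@proj2 (0 < \prod_v p v)).
apply: (big_rec2 (fun q s => 0 < q /\ ln q = s)) => [|v q s _ [q0 <-]].
  by rewrite ltr01 ln1.
have p0 : 0 < p v by rewrite divr_gt0 ?exp_quotient_gt0.
rewrite mulr_gt0 // lnM ?posrE //; split=> //; congr (_ + _).
by rewrite ln_div ?posrE ?exp_quotient_gt0.
Qed.

(** Rescaling the argument by z multiplies the n-th coefficient by z^n. *)
Lemma log_mgf_inversions_derive1n k :
  (log_mgf inv)^`(k)%classic 0 =
  k`!%:R * log_exp_coeff R k * ((Upsilon T k)%:R - #|V|%:R).
Proof.
rewrite log_mgf_inversions.
have sL := @has_pseries_ln_exp_quotient R.
pose c (v : V) : nat -> R :=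
  (fun n => (subtree_size T v)%:R ^+ n * log_exp_coeff R n) - log_exp_coeff R.
rewrite (@has_pseries_derive1n _ (\sum_v c v)); last first.
  apply: has_pseries_sum => v.
  exact: (has_pseriesD (has_pseries_scale _ sL) (has_pseriesN sL)).
rewrite -mulrA fct_sumE; congr (_ * _).
rewrite Upsilon_subtree natr_sum -sum1_card natr_sum -sumrB mulr_sumr.
apply: eq_bigr => v _; rewrite natrX mulrBr mulr1 [log_exp_coeff _ _ * _]mulrC.
by [].
Qed.

End TreeMgf.

Theorem theorem1p2 (R : realType) (V : finType) (T : rooted_tree V)
    (d : measure_display) (Omega : measurableType d) (P : probability Omega R)
    (lam : Omega -> labeling V) (lam_unif : uniform_labeling P lam) :
  let I : Omega -> R := inversion_number R T lam in
  let n : R := #|V|%:R in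
  let z : V -> R := fun v => (subtree_size T v)%:R in
  [/\ [/\ ('E_P[I] = (cumulant P I 1)%:E)%E,
          cumulant P I 1 = 2^-1 * (path_length T)%:R
        & 2^-1 * (path_length T)%:R = 2^-1 * ((Upsilon T 1)%:R - n)],
      ('V_P[I] = (cumulant P I 2)%:E)%E /\
      cumulant P I 2 = 12^-1 * ((Upsilon T 2)%:R - n),
      (forall k : nat, (1 <= k)%N ->
         cumulant P I (2 * k + 1)%N = 0 /\
         cumulant P I (2 * k)%N =
           bernoulli R (2 * k)%N / (2 * k)%N%:R * ((Upsilon T (2 * k)%N)%:R - n)),
      (forall t : R,
         'M_P I t =
           (\prod_(v : V)
              (if t == 0 then 1
               else (expR (z v * t) - 1) / (z v * (expR t - 1))))%:E)
    & (forall t : R,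
         [/\ ('M_P (fun w => (I w - fine 'E_P[I]%E)%R) t <=
                (expR (8^-1 * t ^+ 2 * \sum_(v : V) (z v - 1) ^+ 2))%:E)%E,
             expR (8^-1 * t ^+ 2 * \sum_(v : V) (z v - 1) ^+ 2) <=
               expR (8^-1 * t ^+ 2 * \sum_(v : V) z v ^+ 2)
           & expR (8^-1 * t ^+ 2 * \sum_(v : V) z v ^+ 2) =
               expR (8^-1 * t ^+ 2 * (Upsilon T 2)%:R)])].
Proof.
move=> I n z.
pose inv (l : labeling V) : R := (inversions T l)%:R.
have N0 := card_labeling_gt0 V.
have EI : ('E_P[I] = (avg inv)%:E)%E := expectation_uniform_labeling lam_unif inv.
have cumI k : cumulant P I k = k`!%:R * log_exp_coeff R k * ((Upsilon T k)%:R - n).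
  by rewrite (cumulantE T lam_unif) log_mgf_inversions_derive1n.
have cum1 : cumulant P I 1 = 2^-1 * ((Upsilon T 1)%:R - n).
  by rewrite cumI /log_exp_coeff bernoulli_coeff1 factS fact0 /=; congr (_ * _); field.
have mean : avg inv = 2^-1 * ((Upsilon T 1)%:R - n).
  by rewrite -cum1 (cumulantE T lam_unif) log_mgf_derive1.
have path : (path_length T)%:R = (Upsilon T 1)%:R - n :> R.
  by rewrite -path_lengthD natrD addrK.
have cum_ge2 k : (1 < k)%N ->
    cumulant P I k = bernoulli R k / k%:R * ((Upsilon T k)%:R - n).
  move=> k1; rewrite cumI /log_exp_coeff /bernoulli_coeff gtn_eqF // addr0.
  congr (_ * _); have k0 : k%:R != 0 :> R by rewrite pnatr_eq0 -lt0n ltnW.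
  have f0 : k`!%:R != 0 :> R by rewrite pnatr_eq0 -lt0n fact_gt0.
  by field; rewrite f0 k0.
split.
- by rewrite EI mean cum1 path; split.
- split; last by rewrite cum_ge2 // bernoulli2; congr (_ * _); field.
  rewrite (cumulantE T lam_unif) log_mgf_derive2 // /variance unlock EI /=.
  exact: (expectation_uniform_labeling lam_unif (fun l => (inv l - avg inv) ^+ 2)).
- move=> k k1; split; last by apply: cum_ge2; lia.
  rewrite cum_ge2; last by lia.
  by rewrite bernoulli_odd ?mul0r //; [lia | rewrite oddD oddM].
- move=> t; rewrite (mgf_inversions T lam_unif) avg_expR_inversions; congr (_%:E).
  apply: eq_bigr => v _; rewrite uniform_mgfE ?subtree_size_gt0 // /exp_quotient.
  have z0 : z v != 0 by rewrite pnatr_eq0 -lt0n subtree_size_gt0.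
  rewrite mulf_eq0 -/(z v) (negPf z0) /=; have [_|t0] := eqVneq t 0.
    by rewrite divr1.
  by field; rewrite z0 t0 expR_sub1_neq0.
- move=> t; split.
  + have -> : ('M_P (fun w => (I w - fine 'E_P[I]%E)%R) t =
        (avg (fun l => expR ((inv l - avg inv) * t)))%:E)%E.
      rewrite EI /=.
      exact: (expectation_uniform_labeling lam_unif (fun l => expR ((inv l - avg inv) * t))).
    rewrite lee_fin.
    (* The mean is the sum of the means (z_v - 1) / 2 of the ranks, so each factor
       is centred separately. *)
    have -> : avg (fun l => expR ((inv l - avg inv) * t)) =
        \prod_v (expR (- (t * ((z v - 1) / 2))) *
          ((\sum_(j < subtree_size T v) expR (j%:R * t)) / z v)).
      move: (avg inv) mean => m mean.
      rewrite big_split /= -avg_expR_inversions -expR_sum /avg mulrCA; congr (_ * _).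
      rewrite mulr_sumr; apply: eq_bigr => l _; rewrite -expRD; congr expR.
      rewrite mulrBl addrC; congr (_ + _); rewrite mean sumrN -mulr_sumr -mulr_suml.
      rewrite /n -sum1_card natr_sum Upsilon_subtree natr_sum -sumrB.
      by under [in LHS]eq_bigr do rewrite expn1; ring.
    rewrite mulr_sumr expR_sum; apply: ler_prod => v _.
    rewrite mulr_ge0 ?expR_ge0 ?divr_ge0 ?sumr_ge0 //=.
    by rewrite uniform_mgf_le // subtree_size_gt0.
  + rewrite ler_expR ler_wpM2l //; first by rewrite pmulr_rge0 ?invr_gt0 // sqr_ge0.
    apply: ler_sum => v _; have z1 : 1 <= z v by rewrite ler1n subtree_size_gt0.
    by rewrite ler_sqr ?nnegrE; lra.
  + rewrite Upsilon_subtree natr_sum; congr (expR (_ * _)).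
    by apply: eq_bigr => v _; rewrite natrX.
Qed.
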